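(* Let $k\ge 341$ be an integer and let $a$ be a real number with $0<a<1$. If $Q\in\mathbb{R}[x]$ has nonnegative coefficients and the polynomial $$(1+a x^2+x^k)\,Q(x)$$ has all coefficients in $\{0,1\}$, then $Q=0$. *)

(* Defs.v *)
From mathcomp Require Export all_boot all_order all_algebra.
From mathcomp Require Export reals.

(* Main.v *)
Require Import Defs.
From mathcomp Require Import all_boot all_order all_algebra all_field.
From mathcomp Require Import boolp reals.
From mathcomp Require Import ring lra zify.

Import Order.TTheory GRing.Theory Num.Theory.
Local Open Scope ring_scope.

(** Suppose that Q is nonzero; after division by a power of X, Q(0) > 0. Write C
    for the product (1 + a X^2 + X^k) Q, a polynomial with integer coefficients and
    leading coefficient 1. The proof opposes two facts about C.

    Positivity. The condition that every coefficient is 0 or 1 determines the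
    coefficients of Q step by step, and the requirement that they be nonnegative
    forces k to be odd, a <= 1/2, and then the beginning of C: below degree 4k, the
    coefficient of X^i in C is 1 exactly when i is even or i >= k [forced_odd,
    forced_coef]. So (1 - X^2) C = 1 + X^k + O(X^(4k)), with coefficients in
    {-1, 0, 1}, and a root z of C inside the unit disc must satisfy, for g = |z|^-k,
    the inequality (g^2 - g)^2 <= k [root_modulus_bound].

    Arithmetic. Being a multiple of 1 + a X^2 + X^k is a system of integer
    polynomial equations in a, so C is also a multiple of 1 + b X^2 + X^k for each
    conjugate b of a (and for every b if a is transcendental). These conjugates are
    algebraic integers because C is monic, and they are nonzero; the modulus of
    their product is thus at least 1, and there is such a b with |b| >= 1
    [conjugate_outside_disc].

    The trinomial 1 + b X^2 + X^k with |b| >= 1 has a root too small for the bound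
    above [trinomial_large_root]: if it had none, the power sums p_n of the inverses
    of its roots would be small, but p_(2k) = 2 (-b)^k + k, and
    p_(5k-2) = - (-b)^(k-1) (5k - 2) ((-b)^k + k (k + 1) / 6), and they cannot both
    be small. *)

(** * Trinomials *)

Definition trinomial (F : nzRingType) (k : nat) (a : F) : {poly F} :=
  1 + a *: 'X^2 + 'X^k.

Lemma coef_trinomialM (F : comNzRingType) k (a : F) (Q : {poly F}) i :
  (trinomial F k a * Q)`_i =
    Q`_i + a * (if (i < 2)%N then 0 else Q`_(i - 2))
         + (if (i < k)%N then 0 else Q`_(i - k)).
Proof. by rewrite /trinomial !mulrDl mul1r -scalerAl !coefD coefZ !coefXnM. Qed.

Lemma coef_trinomial (F : comNzRingType) k (a : F) i :
  (trinomial F k a)`_i = (i == 0%N)%:R + a * (i == 2)%:R + (i == k)%:R.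
Proof. by rewrite /trinomial !coefD coefZ coef1 !coefXn. Qed.

Lemma size_trinomial (F : comNzRingType) k (a : F) :
  (2 < k)%N -> size (trinomial F k a) = k.+1.
Proof.
move=> k2; rewrite /trinomial addrC size_polyDl ?size_polyXn // ltnS.
rewrite (leq_trans (size_polyD _ _)) // geq_max size_poly1.
by rewrite (leq_trans (size_scale_leq _ _)) ?size_polyXn //; lia.
Qed.

Lemma trinomial_monic (F : comNzRingType) k (a : F) :
  (2 < k)%N -> trinomial F k a \is monic.
Proof.
move=> k2; rewrite monicE lead_coefE size_trinomial // coef_trinomial eqxx.
by rewrite !gtn_eqF ?mulr0 ?add0r //; lia.
Qed.

(** The constant term 1 allows the factorization over the inverses of the roots,
    the form that Newton's identities use. *)
Lemma trinomial_factor (b : algC) k : (2 < k)%N ->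
  exists2 s : seq algC, size s = k & trinomial algC k b = \prod_(y <- s) (1 - y *: 'X).
Proof.
move=> k2; have [r rE] := closed_field_poly_normal (trinomial algC k b).
rewrite (monicP (trinomial_monic _ _ _ k2)) scale1r in rE.
have sr : size r = k.
  by have := size_trinomial _ k b k2; rewrite rE size_prod_XsubC => -[].
have r0 : \prod_(z <- r) (- z) = 1.
  have := coef_trinomial _ k b 0; rewrite rE -horner_coef0 horner_prod.
  under eq_bigr do rewrite hornerXsubC sub0r.
  have -> : (0%N == k) = false by lia.
  by rewrite mulr0 !addr0.
exists [seq z^-1 | z <- r]; first by rewrite size_map.
have rn0 : all (fun z => - z != 0) r.
  by rewrite -(@prodf_seq_neq0 _ _ r xpredT) r0 oner_eq0.
rewrite big_map rE -[LHS]scale1r -invr1 -{1}r0 -prodfV -scaler_prod.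
rewrite big_seq [RHS]big_seq; apply: eq_bigr => z /(allP rn0); rewrite oppr_eq0 => z0.
by rewrite scalerBr invrN !scaleNr -[z^-1 *: z%:P]mul_polyC -polyCM mulVf // opprK addrC polyC1.
Qed.

(** * Coefficients forced by positivity *)

(** Here q is the coefficient sequence of Q, normalized by q 0 > 0, and c is that
    of the product. Since c i is 0 or 1, it is 1 as soon as one of q i, q (i - 2),
    q (i - k) is positive, and then q i is computed from the two others. From
    q 0 > 0 this propagates along steps of 2 and of k, which yields ever more values
    of q; their nonnegativity is what restricts k and a. *)
Section ForcedCoefficients.
Variables (R : realFieldType) (k : nat) (a : R) (q : nat -> R).
Hypotheses (k_gt2 : (2 < k)%N) (a_gt0 : 0 < a) (a_lt1 : a < 1).
Hypotheses (q_ge0 : forall i, 0 <= q i) (q0_gt0 : 0 < q 0%N).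

Local Ltac lra_a := move: a_gt0 a_lt1 => *; lra.

Let c i := q i + a * (if (i < 2)%N then 0 else q (i - 2)%N)
               + (if (i < k)%N then 0 else q (i - k)%N).
Hypothesis c01 : forall i, c i = 0 \/ c i = 1.

Let lagg_ge0 i : 0 <= a * (if (i < 2)%N then 0 else q (i - 2)%N).
Proof. by case: ifP => _; rewrite ?mulr0 // mulr_ge0 // ltW. Qed.

Let lagk_ge0 i : 0 <= (if (i < k)%N then 0 else q (i - k)%N).
Proof. by case: ifP. Qed.

Let c_eq1 i : 0 < c i -> c i = 1.
Proof. by case: (c01 i) => -> //; rewrite ltxx. Qed.

Let q_le1 i : q i <= 1.
Proof.
have := lagg_ge0 i; have := lagk_ge0 i; have := c01 i; rewrite /c; lra_a.
Qed.

Let q_gt0_c i : 0 < q i -> c i = 1.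
Proof.
move=> qi; apply: c_eq1; have := lagg_ge0 i; have := lagk_ge0 i; rewrite /c; lra_a.
Qed.

Let c_shift2 i : 0 < q i -> c i.+2 = 1.
Proof.
move=> qi; apply: c_eq1; have := lagk_ge0 i.+2; have := q_ge0 i.+2.
rewrite /c !ltnS ltn0 subn2 /=; have := mulr_gt0 a_gt0 qi; lra_a.
Qed.

Let c_shiftk i : 0 < q i -> c (i + k)%N = 1.
Proof.
move=> qi; apply: c_eq1; have := lagg_ge0 (i + k); have := q_ge0 (i + k).
rewrite /c [X in (if X then 0 else q (_ - k)%N)]ltnNge leq_addl addnK /=; lra_a.
Qed.

Let q0E : q 0%N = 1.
Proof.
have := q_gt0_c 0%N q0_gt0; rewrite /c /= (_ : (0 < k)%N = true); last by lia.
lra_a.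
Qed.

Let c2E i : c i.+2 = q i.+2 + a * q i + (if (i.+2 < k)%N then 0 else q (i.+2 - k)%N).
Proof. by rewrite /c !ltnS ltn0 subn2 /=. Qed.

Let even_low i : (i.*2 < k)%N -> 0 < q i.*2.
Proof.
elim: i => // i IH; rewrite doubleS => ltk.
have qi : 0 < q i.*2 by apply: IH; lia.
have := c_shift2 _ qi; rewrite c2E ltk.
have : a * q i.*2 <= a * 1 by rewrite ler_pM2l.
lra_a.
Qed.

Let kE : k = (k - 2).+2. Proof. lia. Qed.

Let ck : q k + a * q (k - 2)%N = 0.
Proof.
have := c_shiftk 0 q0_gt0; rewrite add0n {1 2}kE c2E -kE ltnn subnn q0E; lra_a.
Qed.

(** For even k, the summands a q (k - 2) > 0 and q 0 = 1 of c k would add up to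
    more than 1. *)
Lemma forced_odd : odd k.
Proof.
apply/negPn/negP => kev.
have := even_low (k./2.-1); rewrite (_ : (k./2.-1).*2 = (k - 2)%N); last first.
  by have := odd_double_half k; rewrite (negbTE kev); lia.
move=> /(_ ltac:(lia)) h; have := ck; have := q_ge0 k.
have := mulr_gt0 a_gt0 h; lra_a.
Qed.

(** c k already contains q 0 = 1, hence q (k - 2) = 0, whereas a positive q at an
    odd index would propagate by steps of 2 up to k - 2. *)
Let odd_low i : odd i -> (i <= k)%N -> q i = 0.
Proof.
have qk0 : q k = 0 /\ q (k - 2)%N = 0.
  have := ck; have := q_ge0 k; have h2 := q_ge0 (k - 2).
  have := mulr_ge0 (ltW a_gt0) h2 => h3 h4 h5.
  have h6 : a * q (k - 2)%N = 0 by lra_a.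
  split; first lra_a.
  by move/eqP: h6; rewrite mulf_eq0 => /orP[/eqP h|/eqP//]; lra_a.
have main n : forall i, odd i -> (i < k)%N -> (k - i <= n)%N -> q i = 0.
  elim: n => [|n IH] j oj jk jn; first by lia.
  have [->|jne] := eqVneq j (k - 2)%N; first by case: qk0.
  have j2 : (j.+2 < k)%N by have := forced_odd; lia.
  have qj2 : q j.+2 = 0 by apply: IH => //=; [rewrite negbK | lia].
  have := q_ge0 j; rewrite le_eqVlt => /orP[/eqP //|qj].
  have := c_shift2 _ qj; rewrite c2E j2 qj2.
  have : a * q j <= a * 1 by rewrite ler_pM2l.
  lra_a.
move=> oi; rewrite leq_eqVlt => /orP[/eqP->|ik]; first by case: qk0.
exact: (main k i oi ik (leq_subr _ _)).
Qed.

Let even_mid i : (i.*2 < 2 * k)%N ->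
  0 < q i.*2 /\ forall j, i = j.+1 -> q i.*2 = 1 - a * q j.*2.
Proof.
elim: i => [|i IH]; first by split.
rewrite doubleS => ltk.
have [qi _] := IH ltac:(lia).
have : c (i.*2).+2 = q i.*2.+2 + a * q i.*2.
  rewrite c2E; case: ifP => h; rewrite ?addr0 // (odd_low (_ - _)%N) ?addr0 //; last lia.
  by have := forced_odd; lia.
rewrite c_shift2 // => e.
have : a * q i.*2 <= a * 1 by rewrite ler_pM2l.
split; first lra_a.
by move=> j [<-]; lra_a.
Qed.

Let even_mid_lt1 i : (0 < i)%N -> (i.*2 < 2 * k)%N -> q i.*2 < 1.
Proof.
case: i => // i _ h; have [_ /(_ _ erefl) ->] := even_mid i.+1 h.
have [p _] := even_mid i ltac:(lia); have := mulr_gt0 a_gt0 p; lra_a.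
Qed.

Let odd_rec i : (i.*2 < 2 * k)%N -> c (i.*2 + k)%N = 1.
Proof. by move=> h; apply: c_shiftk; have [] := even_mid i h. Qed.

Let odd_eq i : (i.*2.+2 < 2 * k)%N ->
  q (i.*2.+2 + k)%N + a * q (i.*2 + k)%N = a * q i.*2.
Proof.
move=> h; have := odd_rec i.+1 h; rewrite doubleS.
rewrite !addSn c2E -addSn -addSn ltnNge leq_addl addnK /=.
have [_ /(_ _ erefl)] := even_mid i.+1 h; rewrite doubleS => ->; lra_a.
Qed.

Let odd_k2 : q (2 + k)%N = a.
Proof.
have := odd_eq 0 ltac:(lia); rewrite /= add0n (odd_low k) //; last exact: forced_odd.
by rewrite q0E mulr0 mulr1 addr0.
Qed.

(** The recurrence gives q (k + 4) = a - 2 a^2. *)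
Lemma forced_le_half : a <= 1/2.
Proof.
have := odd_eq 1 ltac:(lia); rewrite /= odd_k2.
have [_ /(_ _ erefl)] := even_mid 1 ltac:(lia); rewrite /= q0E => -> e.
have : 0 <= a - a * a * 2 by have := q_ge0 (4 + k); lra_a.
rewrite (_ : a - a * a * 2 = a * (1 - a * 2)); last by ring.
rewrite pmulr_rge0 //; lra_a.
Qed.

Let odd_mid i : (0 < i)%N -> (i.*2.+2 < 2 * k)%N -> q (i.*2.+2 + k)%N < a.
Proof.
move=> i0 h; have := odd_eq i h; have := even_mid_lt1 i i0 ltac:(lia).
rewrite -(ltr_pM2l a_gt0) => h1 h2.
have := mulr_ge0 (ltW a_gt0) (q_ge0 (i.*2 + k)); lra_a.
Qed.

(** On this range q (i - k) is at most a, being equal to a only for i = 2k + 2,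
    and a q (i - 2) <= a, so q i = 1 - a q (i - 2) - q (i - k) >= 1 - 2 a >= 0. One
    of the two estimates has to be strict, and q (2k) < 1 settles the exceptional
    index. *)
Let even_high i : (i.*2 < 2 * k)%N -> 0 < q (i.*2 + 2 * k)%N /\
  (i = 0%N -> q (i.*2 + 2 * k)%N < 1).
Proof.
have c_eq j : (1 < j)%N -> 0 < q (j.-2)  ->
    q j + a * q j.-2 + (if (j < k)%N then 0 else q (j - k)%N) = 1.
  by move: j => [|[|j]] // _ qj; rewrite -(c_shift2 _ qj) c2E.
have ahalf := forced_le_half.
elim: i => [|i IH] h.
  rewrite double0 add0n.
  have e2 : ((2 * k).-2 = k.-1.*2)%N by lia.
  have [qp _] := even_mid k.-1 ltac:(lia).
  have := c_eq (2 * k)%N ltac:(lia); rewrite e2 => /(_ qp).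
  rewrite ifN; last by lia.
  rewrite (_ : (2 * k - k)%N = k); last by lia.
  rewrite (odd_low k forced_odd (leqnn k)).
  have : a * q k.-1.*2 < a * 1 by rewrite ltr_pM2l //; apply: even_mid_lt1; lia.
  have := mulr_gt0 a_gt0 qp; lra_a.
have [qp qp1] := IH ltac:(lia).
have := c_eq (i.+1.*2 + 2 * k)%N ltac:(lia).
rewrite (_ : (i.+1.*2 + 2 * k).-2 = i.*2 + 2 * k)%N; last by lia.
move/(_ qp); rewrite ifN; last by lia.
rewrite (_ : (i.+1.*2 + 2 * k - k = i.*2.+2 + k))%N; last by lia.
move=> e; split; last by [].
case: (posnP i) e => [i0|ipos].
  rewrite i0 odd_k2 => e; have : a * q (0.*2 + 2 * k)%N < a * 1.
    by rewrite ltr_pM2l //; rewrite -{1}i0 qp1.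
  lra_a.
move=> e; have := odd_mid i ipos ltac:(lia).
have : a * q (i.*2 + 2 * k)%N <= a * 1 by rewrite ler_pM2l.
lra_a.
Qed.

(** Every even index below 4k carries a positive q, hence has coefficient 1, and
    so has each odd index at distance k above one; the odd indices below k have
    only zero summands. *)
Lemma forced_coef i : (i < 4 * k)%N -> c i = (~~ odd i || (k <= i)%N)%:R.
Proof.
have ev j : ~~ odd j -> (j < 4 * k)%N -> 0 < q j.
  move=> oj j4; have jE : j = j./2.*2 by have := odd_double_half j; lia.
  have [jl|jl] := ltnP j (2 * k); first by rewrite jE; have [] := even_mid j./2 ltac:(lia).
  rewrite (_ : j = ((j./2 - k).*2 + 2 * k)%N); last by lia.
  by have [] := even_high (j./2 - k) ltac:(lia).
move=> i4; case oi: (odd i) => /=; last by apply: q_gt0_c; apply: ev; rewrite ?oi.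
have [ki|ik] := leqP k i.
  rewrite -(subnK ki) c_shiftk //; apply: ev; last by lia.
  by have := forced_odd; lia.
rewrite /c ik odd_low //; last by lia.
case: ifP => h; rewrite ?mulr0 ?addr0 // odd_low ?mulr0 ?addr0 //; lia.
Qed.

End ForcedCoefficients.

(** * Power sums of the inverse roots *)

Definition power_sum (F : nzRingType) (s : seq F) (n : nat) : F :=
  \sum_(y <- s) y ^+ n.

(** The identity - X P' = P S, coefficient by coefficient, where P is the product
    of the 1 - y X and S = sum_(n > 0) p_n X^n; the constant term size s added to S
    accounts for the right-hand side. Truncating the generating series at degree
    N keeps the argument inside polynomials. Adding one factor 1 - y X multiplies
    the left-hand side by it and adds P, as (1 - y X) kills the geometric series. *)
Lemma newton_identity (F : comNzRingType) (s : seq F) (N n : nat) : (n < N)%N ->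
  ((\prod_(y <- s) (1 - y *: 'X)) * \poly_(i < N) power_sum F s i)`_n =
    ((size s)%:R - n%:R) * (\prod_(y <- s) (1 - y *: 'X))`_n.
Proof.
elim: s n => [|y s IH] n nN.
  rewrite !big_nil mul1r coef_poly nN /power_sum big_nil coef1.
  by case: n {nN} => [|n]; rewrite ?subrr ?mul0r ?mulr0.
rewrite big_cons; set P := \prod_(z <- s) _ in IH *.
have SE : \poly_(i < N) power_sum F (y :: s) i =
    \poly_(i < N) power_sum F s i + \poly_(i < N) y ^+ i.
  apply/polyP => i; rewrite coefD !coef_poly /power_sum big_cons.
  by case: ifP => _; rewrite ?addr0 // addrC.
have geom : (1 - y *: 'X) * \poly_(i < N) y ^+ i = 1 - y ^+ N *: 'X^N.
  apply/polyP => i; rewrite mulrBl mul1r -scalerAl coefB coefZ coefXM.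
  rewrite coefB coef1 coefZ coefXn !coef_poly.
  case: i => [|i] /=.
    by rewrite (leq_ltn_trans (leq0n n) nN) ltn_eqF ?(leq_ltn_trans _ nN) // !mulr0.
  case: (ltngtP i.+1 N) => h.
  - by rewrite exprS mulr0 !subrr.
  - by rewrite !mulr0 !subrr.
  - by rewrite -h -exprS mulr1.
have linear A i : ((1 - y *: 'X) * A)`_i = A`_i - y * (if i is j.+1 then A`_j else 0).
  by rewrite mulrBl mul1r -scalerAl coefB coefZ coefXM; case: i.
rewrite SE mulrDr coefD -mulrA linear -mulrA mulrCA geom IH // linear.
rewrite mulrBr mulr1 -scalerAr coefB coefZ coefMXn nN mulr0 subr0.
by case: n nN => [|n] nN; rewrite /= ?IH ?(ltnW nN) //; ring.
Qed.

(** For n > 2 the identity reads p n = - b p (n - 2) - p (n - k), without the last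
    term if n < k. As k is odd, each of the blocks p (j k + 2 t), where t < k, is thus
    driven by the block of index j - 1. Dividing by (- b)^t turns the recurrence of
    a block into a summation of the preceding one, so for j = 1, 2, 3 the t-th term
    is (- b)^t times a polynomial in k, t and (- b)^k. *)
Section TrinomialPowerSums.
Variables (F : comNzRingType) (k : nat) (b : F) (p : nat -> F).
Hypothesis p_newton : forall n,
  p n + b * (if (n < 2)%N then 0 else p (n - 2)%N)
      + (if (n < k)%N then 0 else p (n - k)%N)
    = (k%:R - n%:R) * (trinomial F k b)`_n.
Hypotheses (k_odd : odd k) (k_gt2 : (2 < k)%N).

Let p_rec n : (0 < n)%N ->
  p n.+2 = - b * p n - (if (n.+2 < k)%N then 0 else p (n.+2 - k)%N).
Proof.
move=> n2; have := p_newton n.+2; rewrite !ltnS ltn0 subn2 /=.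
have -> : (k%:R - n.+2%:R) * (trinomial F k b)`_n.+2 = 0.
  rewrite /trinomial !coefD coefZ coef1 !coefXn /= !eqSS gtn_eqF // mulr0 !add0r.
  by case: eqP => [<-|_]; rewrite ?subrr ?mul0r ?mulr0.
by move=> h; apply/eqP; rewrite -subr_eq0; apply/eqP; rewrite -[RHS]h; ring.
Qed.

Let p0 : p 0%N = k%:R.
Proof.
have := p_newton 0; rewrite (ltn_trans _ k_gt2) // mulr0 !addr0 subr0 => ->.
rewrite /trinomial !coefD coefZ coef1 !coefXn /= mulr0 addr0 ltn_eqF; last by lia.
by rewrite addr0 mulr1.
Qed.

Let p1 : p 1%N = 0.
Proof.
have := p_newton 1; rewrite (ltn_trans _ k_gt2) // mulr0 !addr0 => ->.
rewrite /trinomial !coefD coefZ coef1 !coefXn /= mulr0 addr0 ltn_eqF; last by lia.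
by rewrite addr0 mulr0.
Qed.

Let p2 : p 2%N = - 2 * b.
Proof.
have := p_newton 2; rewrite k_gt2 addr0 subnn p0 /=.
rewrite /trinomial !coefD coefZ coef1 !coefXn /= ltn_eqF // addr0 add0r mulr1.
by move=> h; rewrite -[LHS](addrK (b * k%:R)) h; ring.
Qed.

Let p_odd t : (t.*2.+1 < k)%N -> p t.*2.+1 = 0.
Proof.
elim: t => [|t IH] h; first exact: p1.
by rewrite doubleS p_rec // IH ?ifT ?mulr0 ?subr0 //; lia.
Qed.

Let p_k : p k = - k%:R.
Proof.
have kE : k = (k - 2).+2 by lia.
rewrite {1}kE p_rec; last by lia.
rewrite -kE ltnn subnn p0 (_ : (k - 2)%N = (k./2.-1).*2.+1); last by lia.
by rewrite p_odd ?mulr0 ?sub0r //; lia.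
Qed.

Let p_even t : (0 < t < k)%N -> p t.*2 = 2 * (- b) ^+ t.
Proof.
elim: t => [//|[|t] IH] h; first by rewrite p2 expr1 mulrN mulNr.
rewrite doubleS p_rec // IH; last by lia.
rewrite [if _ then _ else _](_ : _ = 0); first by rewrite subr0 mulrCA -exprS.
case: ifP => // hk; have := p_odd ((t.+2.*2 - k)./2).
by rewrite (_ : ((t.+2.*2 - k)./2.*2.+1 = t.+1.*2.+2 - k)%N); [apply; lia | lia].
Qed.

Let p_k_even t : (t < k)%N -> p (k + t.*2)%N = - (k + t.*2)%:R * (- b) ^+ t.
Proof.
elim: t => [|t IH] h; first by rewrite addn0 p_k expr0 mulr1.
rewrite doubleS !addnS p_rec; last by lia.
rewrite IH ?ifN; [|lia..].
rewrite (_ : ((k + t.*2).+2 - k)%N = t.+1.*2); last by lia.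
rewrite p_even; last by lia.
rewrite -!addnS -doubleS exprS -!muln2; ring.
Qed.

Lemma power_sum_2k t : (t < k)%N ->
  p (2 * k + t.*2)%N = (- b) ^+ t * (2 * (- b) ^+ k + ((k + t) * t.+1)%:R).
Proof.
elim: t => [|t IH] h.
  rewrite addn0 addn0 muln1 expr0 mul1r.
  rewrite (_ : (2 * k)%N = (k.-1.*2).+2); last by lia.
  rewrite p_rec; last by lia.
  rewrite p_even ?ifN; [|lia..].
  rewrite (_ : (k.-1.*2.+2 - k)%N = k); last by lia.
  rewrite p_k opprK mulrCA -exprS prednK //; lia.
rewrite doubleS !addnS p_rec; last by lia.
rewrite IH ?ifN; [|lia..].
rewrite (_ : ((2 * k + t.*2).+2 - k)%N = (k + t.+1.*2)%N); last by lia.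
rewrite p_k_even // !exprS -!muln2; ring.
Qed.

(** The factor 6 keeps the closed form free of divisions. *)
Lemma power_sum_3k t : (t < k)%N ->
  6%:R * p (3 * k + t.*2)%N =
    - (- b) ^+ t * (3 * k + t.*2)%:R * (6%:R * (- b) ^+ k + (t.+1 * t.+2)%:R).
Proof.
elim: t => [|t IH] h.
  rewrite addn0 expr0.
  rewrite [X in p X](_ : (3 * k)%N = (k + k.-1.*2).+2); last by lia.
  rewrite p_rec; last by lia.
  rewrite p_k_even ?ifN; [|lia..].
  rewrite (_ : ((k + k.-1.*2).+2 - k)%N = 2 * k + 0.*2)%N; last by lia.
  rewrite power_sum_2k; last by lia.
  have bE : - b * (- b) ^+ k.-1 = (- b) ^+ k by rewrite -exprS prednK //; lia.
  have kE : k.-1%:R = k%:R - 1 :> F by rewrite -subn1 natrB //; lia.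
  rewrite mulrCA bE -!muln2 natrD natrM kE; ring.
rewrite doubleS !addnS p_rec; last by lia.
rewrite ifN; last by lia.
rewrite (_ : ((3 * k + t.*2).+2 - k)%N = (2 * k + t.+1.*2)%N); last by lia.
rewrite power_sum_2k // mulrBr mulrCA IH; last by lia.
rewrite !exprS -!muln2; ring.
Qed.

End TrinomialPowerSums.

Lemma le_power_sum (F : numDomainType) (s : seq F) n (M : F) :
  (forall y, y \in s -> `|y| ^+ n <= M) -> `|power_sum F s n| <= (size s)%:R * M.
Proof.
rewrite /power_sum; elim: s => [|y s IH] H; first by rewrite big_nil normr0 mul0r.
rewrite big_cons /= -natr1 mulrDl mul1r addrC; apply: le_trans (ler_normD _ _) _.
by rewrite lerD ?normrX ?H ?mem_head // IH // => z zs; rewrite H // inE zs orbT.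
Qed.

Lemma trinomial_newton (F : comNzRingType) k (b : F) (s : seq F) :
  size s = k -> trinomial F k b = \prod_(y <- s) (1 - y *: 'X) ->
  forall n, power_sum F s n + b * (if (n < 2)%N then 0 else power_sum F s (n - 2)%N)
      + (if (n < k)%N then 0 else power_sum F s (n - k)%N)
    = (k%:R - n%:R) * (trinomial F k b)`_n.
Proof.
move=> sk fac n; have := newton_identity F s n.+1 n (ltnSn n).
rewrite -fac sk coef_trinomialM !coef_poly ltnSn => <-.
by rewrite !(leq_ltn_trans (leq_subr _ _) (ltnSn n)).
Qed.

(** When |b| >= 1, the inverse roots cannot all be small. Put B = |b|^k. The first
    bound and p_(2k) = 2 (-b)^k + k limit B to about k^2 / 24; but then, up to a
    power of b, p_(5k-2) has size at least about (5k) (k^2 / 6 - B), of order k^3, while the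
    second bound only allows k^3 / 32. *)
Lemma trinomial_large_root (b : algC) k (s : seq algC) :
    (341 <= k)%N -> odd k -> 1 <= `|b| ->
    size s = k -> trinomial algC k b = \prod_(y <- s) (1 - y *: 'X) ->
    (forall y, y \in s -> 12%:R * `|y| ^+ (2 * k) <= k%:R) ->
    (forall y, y \in s -> 32%:R * `|y| ^+ (5 * k - 2) <= k%:R ^+ 2) ->
  False.
Proof.
move=> hk ok b1 sk fac H2 H5.
have newt := trinomial_newton _ _ _ _ sk fac.
have p2 := power_sum_2k _ _ _ _ newt ok ltac:(lia) 0 ltac:(lia).
have p5 := power_sum_3k _ _ _ _ newt ok ltac:(lia) k.-1 ltac:(lia).
rewrite double0 addn0 expr0 mul1r addn0 muln1 in p2.
rewrite (_ : 3 * k + k.-1.*2 = 5 * k - 2)%N in p5; last by lia.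
rewrite (_ : k.-1.+1 * k.-1.+2 = k * k.+1)%N in p5; last by rewrite prednK //; lia.
set B := `|(- b) ^+ k|.
have hB : 24%:R * B <= (k * k + 12 * k)%:R.
  have : `|power_sum algC s (2 * k)| <= k%:R * (k%:R / 12%:R).
    by rewrite -sk; apply: le_power_sum => y ys; rewrite sk ler_pdivlMr // mulrC H2.
  rewrite p2 => h.
  have : 2 * B <= k%:R * (k%:R / 12%:R) + k%:R.
    rewrite -(ger0_norm (_ : 0 <= 2)) // -normrM.
    have := ler_normB (2 * (- b) ^+ k + k%:R) k%:R; rewrite addrK => /le_trans; apply.
    by rewrite normr_nat lerD2r.
  move/(ler_wpM2l (ler0n algC 12)).
  have <- : 24%:R * B = 12%:R * (2 * B) by ring.
  move=> /le_trans; apply.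
  by rewrite le_eqVlt natrD !natrM; apply/orP; left; apply/eqP; field.
have h5 : 32%:R * ((5 * k - 2)%:R * ((k * k.+1)%:R - 6%:R * B)) <= (6 * k ^ 3)%:R.
  have hp : `|power_sum algC s (5 * k - 2)| <= k%:R * (k%:R ^+ 2 / 32%:R).
    by rewrite -sk; apply: le_power_sum => y ys; rewrite sk ler_pdivlMr // mulrC H5.
  have := congr1 Num.norm p5; rewrite !normrM normrN normrX normrN !normr_nat => e.
  have : (5 * k - 2)%:R * ((k * k.+1)%:R - 6%:R * B) <= 6%:R * (k%:R * (k%:R ^+ 2 / 32%:R)).
    apply: (@le_trans _ _ (6%:R * `|power_sum algC s (5 * k - 2)|)); last first.
      by rewrite ler_wpM2l.
    rewrite e -mulrA; set v := (5 * k - 2)%:R * `|_|.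
    apply: (@le_trans _ _ v); last by rewrite ler_peMl ?exprn_ege1 // mulr_ge0.
    rewrite ler_wpM2l //.
    have := lerB_normD ((k * k.+1)%:R : algC) (6%:R * (- b) ^+ k).
    by rewrite normr_nat normrM normr_nat addrC [X in _ <= `|X|]addrC.
  move/(ler_wpM2l (ler0n algC 32)) => /le_trans; apply.
  by rewrite le_eqVlt natrM natrX; apply/orP; left; apply/eqP; field.
(* Eliminating B between the two bounds leaves an inequality of natural numbers. *)
have : ((32 * (5 * k - 2) * 4 * (k * k.+1))%:R : algC)
       <= (6 * k ^ 3 * 4 + 32 * (5 * k - 2) * (k * k + 12 * k))%:R.
  rewrite natrD -lerBlDr.
  apply: (@le_trans _ _ ((32 * (5 * k - 2) * 4 * (k * k.+1))%:R
                      - (32 * (5 * k - 2))%:R * (24%:R * B))).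
    by rewrite lerD2l lerN2 [leRHS]natrM ler_wpM2l.
  have := ler_wpM2l (ler0n algC 4) h5; rewrite -natrM (mulnC 4) => h; apply: le_trans h.
  by rewrite le_eqVlt; apply/orP; left; apply/eqP; rewrite !natrM; ring.
rewrite ler_nat; move: hk; clear; nia.
Qed.

(** * Roots of polynomials with the forced initial coefficients *)

(** For g >= 5 the hypothesis gives g^4 <= (25/16) K, from which the bounds on
    smaller and larger powers follow with room to spare; for g < 5 they hold
    because K >= 341. *)
Lemma quartic_growth_bound (F : realFieldType) (K g : F) :
  341%:R <= K -> 1 <= g -> (g ^+ 2 - g) ^+ 2 <= K ->
  12%:R * g ^+ 2 <= K /\ 32%:R * g ^+ 5 <= K ^+ 2.
Proof.
move=> hK g1 hg; have [g5|g5] := leP g 5%:R.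
  have g2 : g ^+ 2 <= 25%:R by nra.
  have g4 : g ^+ 4 <= 625%:R.
    by rewrite (exprM g 2 2) [in X in X <= _]expr2; have := sqr_ge0 g; nra.
  have g5' : g ^+ 5 <= 3125%:R by rewrite exprS; nra.
  by split; [lra | nra].
have g4 : 16%:R * g ^+ 4 <= 25%:R * K.
  have h : 4%:R * g ^+ 2 <= 5%:R * (g ^+ 2 - g) by nra.
  have h0 : 0 <= g ^+ 2 by exact: sqr_ge0.
  by rewrite (exprM g 2 2); nra.
have g2 : 16%:R * g ^+ 2 <= K.
  have h0 : 25%:R <= g ^+ 2 by nra.
  by move: g4; rewrite (exprM g 2 2); nra.
split; first by have := sqr_ge0 g; lra.
have gK : 80%:R * g <= K by nra.
have g40 : 0 <= g ^+ 4 by rewrite exprn_ge0; lra.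
rewrite exprS.
have : (80%:R * g) * (16%:R * g ^+ 4) <= K * (25%:R * K) by apply: ler_pM => //; lra.
have : 0 <= K * K by nra.
by rewrite expr2; lra.
Qed.

(** With g = r^-k, the geometric sums of length n and of length k give
    (1 - r^k)^2 <= k r^(4k), that is (g^2 - g)^2 <= k. *)
Lemma small_root_bound (F : realFieldType) (k n : nat) (r : F) :
  (341 <= k)%N -> 0 < r -> 1 - r ^+ k <= r ^+ (4 * k) * \sum_(i < n) r ^+ i ->
  12%:R * r^-1 ^+ (2 * k) <= k%:R /\ 32%:R * r^-1 ^+ (5 * k - 2) <= k%:R ^+ 2.
Proof.
move=> hk r0 hr; have hK : 341%:R <= k%:R :> F by rewrite ler_nat.
have [r1|r1] := leP 1 r.
  have y1 : r^-1 <= 1 by rewrite invf_le1.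
  have y0 : 0 <= r^-1 by rewrite invr_ge0 ltW.
  have h m : r^-1 ^+ m <= 1 by rewrite exprn_ile1.
  by have := h (2 * k)%N; have := h (5 * k - 2)%N; split; nra.
have y1 : 1 <= r^-1 by rewrite invf_ge1 // ltW.
set S := \sum_(i < n) _ in hr.
have hS : (1 - r) * S <= 1.
  by rewrite -[1 - r]opprB mulNr -subrX1 opprB gerBl exprn_ge0 // ltW.
have hk1 : 1 - r ^+ k <= (1 - r) * k%:R.
  rewrite -[1 - r ^+ k]opprB subrX1 -mulNr opprB ler_wpM2l ?subr_ge0 ?(ltW r1) //.
  have -> : k%:R = \sum_(i < k) (1 : F) by rewrite sumr_const card_ord.
  apply: ler_sum => i _.
  by rewrite exprn_ile1 // ltW.
have t0 : 0 < r ^+ k by rewrite exprn_gt0.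
have t1 : r ^+ k <= 1 by rewrite exprn_ile1 // ltW.
have hsq : (1 - r ^+ k) ^+ 2 <= k%:R * r ^+ (4 * k).
  have t40 : 0 <= r ^+ (4 * k) by rewrite exprn_ge0 // ltW.
  have k0 : 0 <= k%:R :> F by [].
  have S0 : 0 <= S by apply: sumr_ge0 => i _; rewrite exprn_ge0 // ltW.
  rewrite expr2; apply: le_trans (ler_pM _ _ hr hk1) _; rewrite ?subr_ge0 //.
  have -> u : u * S * ((1 - r) * k%:R) = (k%:R * u) * ((1 - r) * S) by ring.
  by rewrite ler_piMr // mulr_ge0.
have g0 : 0 < r^-1 ^+ k by rewrite exprn_gt0 // invr_gt0.
have gt : r^-1 ^+ k * r ^+ k = 1 by rewrite exprVn mulVf // gt_eqF.
have g1 : 1 <= r^-1 ^+ k by rewrite exprn_ege1.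
have hg : ((r^-1 ^+ k) ^+ 2 - r^-1 ^+ k) ^+ 2 <= k%:R.
  have r4 : r ^+ (4 * k) = (r ^+ k) ^+ 4 by rewrite mulnC exprM.
  have -> : (r^-1 ^+ k) ^+ 2 - r^-1 ^+ k = (r^-1 ^+ k) ^+ 2 * (1 - r ^+ k).
    by rewrite mulrBr mulr1 expr2 -mulrA gt mulr1.
  have := ler_wpM2l (exprn_ge0 4 (ltW g0)) hsq.
  by rewrite r4 (mulrCA _ k%:R) -(exprMn _ (r^-1 ^+ k)) gt expr1n mulr1 exprMn -(exprM _ 2 2).
have [h2 h5] := quartic_growth_bound _ _ _ hK g1 hg.
split; first by rewrite mulnC exprM.
apply: le_trans h5; rewrite ler_wpM2l // -exprM mulnC; apply: ler_weXn2l => //.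
exact: leq_subr.
Qed.

(** The prescribed coefficients make (1 - X^2) C equal to 1 + X^k up to degree 4k,
    with all later coefficients in {-1, 0, 1}. At a root z of C inside the unit
    disc, |1 + z^k| is therefore at most the tail beyond degree 4k of the geometric
    series of ratio |z|, which keeps z close to the unit circle. *)
Lemma root_modulus_bound (k : nat) (C : {poly int}) (z : algC) :
    (341 <= k)%N -> odd k ->
    (forall i, C`_i = 0 \/ C`_i = 1) ->
    (forall i, (i < 4 * k)%N -> C`_i = (~~ odd i || (k <= i)%N)%:R) ->
    root (map_poly intr C) z -> z != 0 ->
  12%:R * `|z^-1| ^+ (2 * k) <= k%:R /\ 32%:R * `|z^-1| ^+ (5 * k - 2) <= k%:R ^+ 2.
Proof.
move=> hk ok C01 Cinit /rootP Cz z0.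
pose D : {poly int} := (1 - 'X^2) * C.
have DE i : D`_i = C`_i - (if (i < 2)%N then 0 else C`_(i - 2)).
  by rewrite /D mulrBl mul1r coefB coefXnM.
have D1 i : `|D`_i| <= 1.
  rewrite DE; case: ifP => _; case: (C01 i) => ->; rewrite ?subr0 //;
    by case: (C01 (i - 2)%N) => ->.
have Dlow : take_poly (4 * k) D = 1 + 'X^k.
  apply/polyP => i; rewrite coef_take_poly coefD coef1 coefXn.
  case: ltnP => hi; last by rewrite !gtn_eqF //; lia.
  rewrite DE !Cinit //; last by lia.
  case: ltnP => i2.
    have -> : (k <= i)%N = false by lia.
    have -> : (i == k) = false by lia.
    by case: i i2 {hi} => [|[|]].
  have -> : (i == 0%N) = false by lia.
  have -> : (i == k) = odd i && (k <= i)%N && (i - 2 < k)%N by lia.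
  have -> : odd (i - 2) = odd i by lia.
  case: odd => /=; last by rewrite subrr addr0.
  rewrite leqNgt; case: (ltnP (i - 2) k) => h; first by rewrite andbT subr0 add0r.
  have -> : (i < k)%N = false by lia.
  by rewrite subrr addr0.
pose E := map_poly (intr : int -> algC) (drop_poly (4 * k) D).
have DzE : 1 + z ^+ k = - (E.[z] * z ^+ (4 * k)).
  apply/eqP; rewrite -addr_eq0; apply/eqP.
  have <- : (map_poly intr D).[z] = 0 :> algC by rewrite /D rmorphM hornerM Cz mulr0.
  rewrite -[in RHS](poly_take_drop (4 * k) D) Dlow !rmorphD rmorphM /= rmorph1.
  by rewrite !map_polyXn !hornerE.
have Ez : `|E.[z]| <= \sum_(i < size E) `|z| ^+ i.
  rewrite horner_coef; apply: le_trans (ler_norm_sum _ _ _) _.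
  apply: ler_sum => i _; rewrite normrM normrX ler_piMl ?exprn_ge0 //.
  by rewrite coef_map coef_drop_poly /= -intr_norm -[1]/(1%:~R) ler_int.
have hz : 1 - `|z| ^+ k <= `|z| ^+ (4 * k) * \sum_(i < size E) `|z| ^+ i.
  apply: (@le_trans _ _ `|1 + z ^+ k|).
    by rewrite -[1 in leLHS](normr1 algC) -normrX lerB_normD.
  by rewrite DzE normrN normrM normrX mulrC ler_wpM2l ?exprn_ge0.
(* The order of algC is partial, so the real estimate is applied in algR. *)
pose r := in_algR (normr_real z).
have r0 : 0 < r by change (0 < `|z|); rewrite normr_gt0.
have hr : 1 - r ^+ k <= r ^+ (4 * k) * \sum_(i < size E) r ^+ i.
  change (algRval (1 - r ^+ k) <= algRval (r ^+ (4 * k) * \sum_(i < size E) r ^+ i)).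
  rewrite rmorphB rmorph1 rmorphM rmorph_sum !rmorphXn /=.
  by under [X in _ <= _ * X]eq_bigr => i _ do rewrite rmorphXn.
have [b2 b5] := small_root_bound _ _ _ _ hk r0 hr.
rewrite normfV; split.
  have : algRval (12%:R * r^-1 ^+ (2 * k)) <= algRval k%:R := b2.
  by rewrite rmorphM !rmorph_nat rmorphXn fmorphV.
have : algRval (32%:R * r^-1 ^+ (5 * k - 2)) <= algRval (k%:R ^+ 2) := b5.
by rewrite rmorphM !rmorph_nat !rmorphXn rmorph_nat fmorphV.
Qed.

(** * Replacing the parameter by a conjugate *)

(** A nonzero rational polynomial of least degree vanishing at a divides the others
    by Euclidean division; its constant term is nonzero, since a factor X could be
    removed. *)
Lemma min_rat_poly (F : numFieldType) (a : F) (q : {poly int}) :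
    a != 0 -> q != 0 -> root (map_poly intr q) a ->
  exists p : {poly rat}, [/\ p`_0 != 0, (1 < size p)%N &
    forall q : {poly int}, root (map_poly intr q) a -> p %| map_poly intr q].
Proof.
move=> a0 q0 qa.
have intrat (u : {poly int}) : map_poly ratr (map_poly (intr : int -> rat) u) = map_poly intr u :> {poly F}.
  by rewrite -map_poly_comp; apply: eq_map_poly => x /=; rewrite ratr_int.
pose vanishing n := `[< exists p : {poly rat},
   [/\ p != 0, root (map_poly ratr p) a & size p = n] >].
have ex : exists n, vanishing n.
  exists (size (map_poly intr q : {poly rat})); apply/asboolP.
  exists (map_poly intr q); split => //; last by rewrite intrat.
  by rewrite map_poly_eq0_id0 // intr_eq0 lead_coef_eq0.
case: (ex_minnP ex) => n /asboolP[p [p0 pa sp]] minp.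
have minimal r : root (map_poly ratr r) a -> (size r < size p)%N -> r = 0.
  move=> ra; apply: contraTeq => r0; rewrite -leqNgt sp; apply: minp.
  by apply/asboolP; exists r.
exists p; split.
- apply/eqP => p00.
  have pE : p = drop_poly 1 p * 'X.
    rewrite -{1}(poly_take_drop 1 p) (_ : take_poly 1 p = 0) ?add0r ?expr1 //.
    by apply/polyP => -[|i]; rewrite coef_take_poly // coef0.
  have d0 : drop_poly 1 p != 0 by apply: contra_neq p0 => d0; rewrite pE d0 mul0r.
  suff : drop_poly 1 p = 0 by apply/eqP.
  apply: minimal; last by rewrite [in ltnRHS]pE size_mulX.
  have : root (map_poly ratr (drop_poly 1 p * 'X)) a by rewrite -pE.
  by rewrite rmorphM /= map_polyX rootM rootX (negbTE a0) orbF.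
- rewrite ltnNge; apply/negP => /size1_polyC pE; move: pa p0.
  by rewrite pE map_polyC /= rootC fmorph_eq0 polyC_eq0 => ->.
move=> u ua; apply/modp_eq0P; apply: minimal; last by rewrite ltn_modp.
have pdec := congr1 (map_poly (ratr : rat -> F)) (divp_eq (map_poly intr u) p).
move: ua; rewrite -intrat pdec rmorphD rmorphM /= rootE hornerD hornerM.
by rewrite (rootP pa) mulr0 add0r.
Qed.

Definition int_eval (F : comNzRingType) (x : F) : {rmorphism {poly int} -> F} :=
  horner_eval x \o map_poly intr.

(** Division by 1 + T X^2 + X^k is carried out over the integer polynomials in the
    parameter T, written 'X as an element of {poly int}. As the divisor is monic,
    the division specializes to every value of T in every field. *)
Section Remainder.
Variables (k : nat) (C : {poly int}).
Hypothesis k_gt2 : (2 < k)%N.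

Let T : {poly {poly int}} := trinomial {poly int} k 'X.
Let Tmon : T \is monic. Proof. exact: trinomial_monic. Qed.

Lemma map_generic_trinomial (F : comNzRingType) (x : F) :
  map_poly (int_eval F x) (trinomial {poly int} k 'X) = trinomial F k x.
Proof.
rewrite /trinomial !rmorphD rmorph1 /= map_polyZ !map_polyXn.
by rewrite /= map_polyX /horner_eval hornerX.
Qed.

Lemma map_generic_const (F : comNzRingType) (x : F) :
  map_poly (int_eval F x) (map_poly polyC C) = map_poly intr C.
Proof.
rewrite -map_poly_comp; apply: eq_map_poly => c /=.
by rewrite /horner_eval map_polyC hornerC.
Qed.

Definition generic_rem : {poly {poly int}} := Pdiv.Ring.rmodp (map_poly polyC C) T.

(** Divisibility of C by the trinomial of parameter x is thus a system of integer
    polynomial equations in x, which can be moved from one field to another. *)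
Lemma trinomial_dvdP (F : fieldType) (x : F) :
  (forall i, root (map_poly intr generic_rem`_i) x) <->
  exists Q, trinomial F k x * Q = map_poly intr C.
Proof.
have E := Pdiv.RingMonic.rdivp_eq Tmon (map_poly polyC C).
have := congr1 (map_poly (int_eval F x)) E.
rewrite rmorphD rmorphM /= map_generic_const map_generic_trinomial -/generic_rem => EF.
set q := map_poly _ (Pdiv.Ring.rdivp _ _) in EF; set r := map_poly _ generic_rem in EF.
have rE i : r`_i = (map_poly intr generic_rem`_i).[x] by rewrite coef_map.
split=> [rem0 | [Q QE] i].
  exists q; rewrite EF (_ : r = 0 :> {poly F}) ?addr0 1?mulrC //.
  by apply/polyP => i; rewrite coef0 rE; apply/rootP.
apply/rootP; rewrite -rE; suff r0 : r = 0 :> {poly F} by rewrite r0 coef0.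
have rQ : r = trinomial F k x * (Q - q).
  by rewrite mulrBr QE EF [q * _]mulrC addrAC subrr add0r.
have sr : (size r < size (trinomial F k x))%N.
  rewrite size_trinomial // -(size_trinomial {poly int} k 'X k_gt2).
  apply: leq_ltn_trans (size_poly _ _) _; by rewrite Pdiv.Ring.ltn_rmodpN0 ?monic_neq0.
apply/eqP; apply: contraTT sr => r0; rewrite -leqNgt.
by apply: dvdp_leq => //; rewrite rQ dvdp_mulr.
Qed.

End Remainder.

(** The roots of the trinomial are roots of the monic integer polynomial C, and b
    is a polynomial in these roots with integer coefficients. *)
Lemma trinomial_dvd_Aint (b : algC) k (C : {poly int}) (Q : {poly algC}) :
  (2 < k)%N -> C \is monic -> trinomial algC k b * Q = map_poly intr C -> b \in Aint.
Proof.
move=> k2 Cm QE; have [r rE] := closed_field_poly_normal (trinomial algC k b).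
rewrite (monicP (trinomial_monic _ _ _ k2)) scale1r in rE.
have := coef_trinomial algC k b 2; rewrite (_ : (2 == k)%N = false); last by lia.
rewrite /= mulr1 add0r addr0 => <-; rewrite rE.
suff /polyOverP : \prod_(z <- r) ('X - z%:P) \is a polyOver Aint by apply.
rewrite big_seq; apply: rpred_prod => z zr; rewrite polyOverXsubC.
apply: (@root_monic_Aint (map_poly intr C)).
- by rewrite -QE rootM rE root_prod_XsubC zr.
- exact: monic_map.
by apply/polyOverP => i; rewrite coef_map /= intr_int.
Qed.

(** The parameter a may be replaced by any of its conjugates. These are nonzero
    algebraic integers whose product is rational, hence a nonzero integer, so one
    of them has modulus at least 1. *)
Lemma conjugate_outside_disc (F : numFieldType) k (C : {poly int}) (a : F) (Q : {poly F}) :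
    (2 < k)%N -> C \is monic -> a != 0 -> trinomial F k a * Q = map_poly intr C ->
  exists2 b : algC, 1 <= `|b| & exists Q', trinomial algC k b * Q' = map_poly intr C.
Proof.
move=> k2 Cm a0 QE.
have rem_a : forall i, root (map_poly intr (generic_rem k C)`_i) a.
  by apply/(trinomial_dvdP k C k2); exists Q.
have [rem0|rem_neq0] := eqVneq (generic_rem k C) 0.
  (* With a zero remainder every parameter is admissible. *)
  exists 1; first by rewrite normr1.
  apply/(trinomial_dvdP k C k2) => i; by rewrite rem0 coef0 rmorph0 root0.
have [p [p0 sp pdvd]] : exists p : {poly rat}, [/\ p`_0 != 0, (1 < size p)%N &
    forall q : {poly int}, root (map_poly intr q) a -> p %| map_poly intr q].
  by apply: min_rat_poly a0 _ (rem_a (size (generic_rem k C)).-1); rewrite lead_coef_eq0.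
have conj b : root (map_poly ratr p) b -> exists Q', trinomial algC k b * Q' = map_poly intr C.
  move=> pb; apply/(trinomial_dvdP k C k2) => i.
  have /dvdpP[u uE] := pdvd _ (rem_a i).
  have -> : map_poly intr (generic_rem k C)`_i = map_poly ratr (u * p) :> {poly algC}.
    rewrite -uE -map_poly_comp; apply: eq_map_poly => x /=; by rewrite ratr_int.
  by rewrite rmorphM rootM pb orbT.
have [r rE] := closed_field_poly_normal (map_poly ratr p : {poly algC}).
have pn0 : p != 0 by apply: contraTneq sp => ->; rewrite size_poly0.
have lp0 : lead_coef (map_poly (ratr : rat -> algC) p) != 0.
  by rewrite lead_coef_eq0 map_poly_eq0.
have rroot b : b \in r -> root (map_poly ratr p) b.
  by move=> br; rewrite rE rootZ // root_prod_XsubC.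
have sr : (0 < size r)%N.
  by have := sp; rewrite -(size_map_poly (ratr : rat -> algC)) rE size_scale // size_prod_XsubC.
have prE : \prod_(z <- r) (- z) = ratr (p`_0 / lead_coef p).
  have <- : (\prod_(z <- r) ('X - z%:P))`_0 = \prod_(z <- r) (- z).
    rewrite -horner_coef0 horner_prod; apply: eq_bigr => z _.
    by rewrite hornerXsubC sub0r.
  have := congr1 (fun u : {poly algC} => u`_0) rE.
  rewrite coefZ coef_map lead_coef_map fmorph_div /= => ->.
  by rewrite mulrAC divff ?mul1r // fmorph_eq0 lead_coef_eq0.
have int_prod : \prod_(z <- r) (- z) \in Num.int.
  apply: Cint_rat_Aint; first by rewrite prE Crat_rat.
  rewrite big_seq; apply: rpred_prod => z zr; rewrite rpredN.
  by have [Q' Q'E] := conj z (rroot z zr); exact: trinomial_dvd_Aint k2 Cm Q'E.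
have norm_prod : 1 <= `|\prod_(z <- r) (- z)|.
  apply: norm_intr_ge1 => //; rewrite prE fmorph_eq0 mulf_neq0 // invr_eq0.
  by rewrite lead_coef_eq0.
have [/hasP[b br b1]|/hasPn small] := boolP (has (fun b => 1 <= `|b|) r).
  by exists b => //; exact: conj (rroot b br).
suff : `|\prod_(z <- r) (- z)| < 1 by move=> /lt_geF; rewrite norm_prod.
have lt1 z : z \in r -> `|z| < 1.
  by move=> /small; rewrite real_ltNge ?normr_real ?real1.
rewrite normr_prod; case: (r) sr lt1 => // z s _ lt1.
rewrite big_cons normrN; apply: (@le_lt_trans _ _ `|z|); last by rewrite lt1 ?mem_head.
rewrite ler_piMr // big_seq prodr_ile1 // => y ys.
by rewrite normrN normr_ge0 ltW // lt1 // inE ys orbT.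
Qed.

(** * Conclusion *)

Lemma zero_one_lift (F : numFieldType) (p : {poly F}) :
  (forall i, p`_i = 0 \/ p`_i = 1) ->
  exists2 C : {poly int}, map_poly intr C = p & forall i, C`_i = 0 \/ C`_i = 1.
Proof.
move=> p01; exists (\poly_(i < size p) (p`_i == 1)%:R).
  apply/polyP => i; rewrite coef_map coef_poly /= -[in RHS](coefK p) coef_poly.
  by case: ifP => // _; case: (p01 i) => ->; rewrite ?eqxx // eq_sym oner_eq0.
by move=> i; rewrite coef_poly; case: ifP; [case: eqP; [right|left]|left].
Qed.

(** The hypothesis on the constant term is the normalization obtained by removing
    from Q its largest power of X. *)
Lemma no_zero_one_multiple (R : realFieldType) (k : nat) (a : R) (Q : {poly R}) :
    (341 <= k)%N -> 0 < a -> a < 1 -> (forall i, 0 <= Q`_i) -> Q`_0 != 0 ->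
    (forall i, (trinomial R k a * Q)`_i = 0 \/ (trinomial R k a * Q)`_i = 1) ->
  False.
Proof.
move=> hk a0 a1 Q0 Q00 h01.
have k2 : (2 < k)%N by lia.
have Q0_gt0 : 0 < Q`_0 by rewrite lt_def Q00 Q0.
have ok : odd k.
  by apply: (forced_odd R k a (fun i => Q`_i)) => // i; rewrite -coef_trinomialM.
have [C CE C01] := zero_one_lift _ _ h01.
have Cinit i : (i < 4 * k)%N -> C`_i = (~~ odd i || (k <= i)%N)%:R.
  move=> hi; apply/eqP; rewrite -(eqr_int R) -coef_map /= CE coef_trinomialM.
  rewrite (forced_coef R k a (fun i => Q`_i)) // => [|j]; last by rewrite -coef_trinomialM.
  by rewrite rmorph_nat.
have Cn0 : C != 0.
  by apply/eqP => C0; have := Cinit 0 ltac:(lia); rewrite C0 coef0.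
have Cm : C \is monic.
  have : lead_coef C != 0 by rewrite lead_coef_eq0.
  by rewrite monicE lead_coefE; case: (C01 (size C).-1) => ->.
have [b b1 [Q' Q'E]] := conjugate_outside_disc _ _ _ _ _ k2 Cm (lt0r_neq0 a0) (esym CE).
have [s sk fac] := trinomial_factor b k k2.
have bound y : y \in s -> 12%:R * `|y| ^+ (2 * k) <= k%:R /\
                          32%:R * `|y| ^+ (5 * k - 2) <= k%:R ^+ 2.
  move=> ys; have [->|y0] := eqVneq y 0.
    by rewrite normr0 !expr0n !gtn_eqF ?mulr0 ?ler0n ?exprn_ge0 //; lia.
  rewrite -[y]invrK; apply: (root_modulus_bound _ C) => //; last by rewrite invr_eq0.
  rewrite -Q'E rootM fac; apply/orP; left; rewrite rootE horner_prod.
  apply/eqP; rewrite (big_rem y) //= !hornerE mulfV // subrr mul0r //.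
by apply: (trinomial_large_root b k s hk ok b1 sk fac) => y /bound[].
Qed.

Theorem theorem1p2 (R : realType) (k : nat) (a : R) (Q : {poly R})
  (hk : (341 <= k)%N) (ha0 : 0 < a) (ha1 : a < 1)
  (hQ : forall i : nat, 0 <= Q`_i)
  (hPQ : forall i : nat,
    ((1 + a *: 'X^2 + 'X^k) * Q)`_i = 0 \/ ((1 + a *: 'X^2 + 'X^k) * Q)`_i = 1) :
  Q = 0.
Proof.
have [//|Qn0] := eqVneq Q 0; exfalso.
have ex : exists n, Q`_n != 0 by exists (size Q).-1; rewrite lead_coef_eq0.
case: (ex_minnP ex) => n Qn minn.
have QE : Q = drop_poly n Q * 'X^n.
  rewrite -{1}(poly_take_drop n Q) (_ : take_poly n Q = 0) ?add0r //.
  apply/polyP => i; rewrite coef_take_poly coef0; case: ltnP => // ni.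
  by apply/eqP; apply: contraTT ni => /minn; rewrite -leqNgt.
apply: (@no_zero_one_multiple R k a (drop_poly n Q) hk ha0 ha1) => [i||i].
- by rewrite coef_drop_poly.
- by rewrite coef_drop_poly.
have <- : (trinomial R k a * Q)`_(i + n) = (trinomial R k a * drop_poly n Q)`_i.
  by rewrite {1}QE mulrA coefMXn ltnNge leq_addl addnK.
exact: hPQ.
Qed.
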